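(* For each positive integer $k$, let $\alpha(k)$ be the infimum of those $\alpha$ such that every election has a committee of size $k$ that is $\alpha$-undominated. Then $\frac{\alpha(k)}{1 - \ln\alpha(k)} \leq \frac{2}{k+1}$, and $$\alpha(k) \leq \min_{1 \leq k' < k} \left(\left(\frac{k'}{k}\right)^2 \alpha(k') + \frac{4\ln \frac{k}{k'}}{k - k'}\right).$$
   Context: An election consists of a finite set $V$ of $n$ voters, a finite set $C$ of candidates, and for each voter $v$ a strict linear order $\succ_v$ on $C$. A committee is a subset $S \subseteq C$. For a candidate $a$ and committee $S$, write $a \succ_v S$ if $v$ prefers $a$ to every member of $S$, and let $\frac1n|a \succ S| = \frac1n|\{v \in V : a \succ_v S\}|$. A committee $S$ is $\alpha$-undominated if for every candidate $a \in C$, $\frac1n|a \succ S| < \alpha$. The minimum over $1 \le k' < k$ is over integers $k'$. *)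

(* Defs.v *)
From HB Require Import structures.
From mathcomp Require Import all_boot all_order all_algebra.
From mathcomp Require Import all_classical all_reals all_analysis.
Set Implicit Arguments. Unset Strict Implicit. Unset Printing Implicit Defensive.
Import Order.TTheory GRing.Theory Num.Theory.
Local Open Scope ring_scope.

Definition strict_linear_order (C : finType) (r : rel C) : Prop :=
  irreflexive r /\ transitive r /\ (forall a b : C, a != b -> r a b || r b a).

(* pref v a b  means  a >_v b  (voter v strictly prefers a to b). *)
Definition prefers_to_all (C : finType) (r : rel C) (a : C) (S : {set C}) : bool :=
  [forall b in S, r a b].

Definition dom_share (R : realType) (V C : finType) (pref : V -> rel C)
    (a : C) (S : {set C}) : R :=
  (#|[set v : V | prefers_to_all (pref v) a S]|%:R / #|V|%:R).

Definition undominated (R : realType) (V C : finType) (pref : V -> rel C)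
    (alpha : R) (S : {set C}) : Prop :=
  forall a : C, @dom_share R V C pref a S < alpha.

(* alpha(k): infimum of those alpha such that every election (with n >= 1
   voters and at least k candidates, so that committees of size k exist)
   has an alpha-undominated committee of size k. *)
Definition alpha_k (R : realType) (k : nat) : R :=
  inf [set x : R | forall (V C : finType) (pref : V -> rel C),
         (0 < #|V|)%N -> (k <= #|C|)%N ->
         (forall v, strict_linear_order (pref v)) ->
         exists S : {set C}, #|S| = k /\ @undominated R V C pref x S].

(* Main.v *)
Require Import Defs.
From HB Require Import structures.
From mathcomp Require Import all_boot all_order all_algebra.
From mathcomp Require Import all_classical all_reals all_analysis.
From mathcomp Require Import ring lra.
Set Implicit Arguments. Unset Strict Implicit. Unset Printing Implicit Defensive.
Import Order.TTheory GRing.Theory Num.Theory.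
Local Open Scope ring_scope.

(* Fix a lottery D on the candidates and let F_v(a) be the D-mass of the candidates
   that v ranks at or above a. If a is itself drawn from D, the expectation of
   (w - F_v(a))^+ is at most w^2/2. Playing a no-regret strategy against this payoff
   and averaging the plays, which is legitimate because the payoff is convex in D,
   gives a lottery D such that the voter average of (w - F_v(a))^+ is at most
   w^2/2 + eps for every candidate a.

   Draw m candidates from D to form S, and let Y_v be the D-mass ranked by v above
   all of S. Then P(Y_v > t) <= (1-t)^m, and a >_v S forces F_v(a) <= Y_v. The two
   bounds come from combining these facts in two ways.
   - The indicator of a >_v S is at most ((w - F_v(a))^+ + (Y_v - e)^+) / (w - e), so
     its average is at most (w^2/2 + (1-e)^(k+1)/(k+1)) / (w - e) + eps. With
     w = alpha(k) and (1-e)^k = alpha(k) this is < alpha(k) unless the first bound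
     holds, since e <= - ln alpha(k) / k.
   - With m = k - k' and (1-t)^m = (k'/k)^2, at most (k'/k)^2 n voters have Y_v > t;
     a committee of size k' handles them, and among the other voters taking w = 2t
     shows that a beats S at most (2t + eps) n times. *)

(** * Lotteries and the payoff of a lottery against itself *)

Definition lottery (R : realType) (C : finType) (D : C -> R) : Prop :=
  (forall a, 0 <= D a) /\ \sum_a D a = 1.

Definition mass_ge (R : realType) (C : finType) (r : rel C) (D : C -> R) (a : C) : R :=
  \sum_(b | (b == a) || r b a) D b.

Definition mass_above (R : realType) (C : finType) (r : rel C) (D : C -> R) (s : seq C) : R :=
  \sum_(b | all (r b) s) D b.

Lemma ler_sum_subpred (R : realType) (C : finType) (D : C -> R) (P Q : pred C) :
  (forall a, 0 <= D a) -> (forall a, P a -> Q a) ->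
  \sum_(a | P a) D a <= \sum_(a | Q a) D a.
Proof.
move=> D0 PQ; rewrite [leRHS](bigID P) /=.
rewrite (eq_bigl (fun a => Q a && P a)); last first.
  by move=> a; case: (boolP (P a)) => [/PQ -> //|]; rewrite andbF.
by rewrite lerDl sumr_ge0.
Qed.

Lemma sum_const_card (R : realType) (I : finType) (x : R) : \sum_(i : I) x = #|I|%:R * x.
Proof. by rewrite sumr_const mulr_natl. Qed.

(** Only candidates with [mass_ge] below [w] contribute; let [s] be their total mass. By totality
    every pair of them is counted in at least one order, so the [D]-weighted sum of their [mass_ge]
    is at least [s ^+ 2 / 2], and [w * s - s ^+ 2 / 2 <= w ^+ 2 / 2]. *)
Lemma lottery_self_payoff (R : realType) (C : finType) (r : rel C) (D : C -> R) (w : R) :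
  strict_linear_order r -> (forall a, 0 <= D a) ->
  \sum_a D a * Num.max 0 (w - mass_ge r D a) <= w ^+ 2 / 2.
Proof.
move=> [_ [_ tot]] D0.
pose P a := mass_ge r D a < w; pose s := \sum_(a | P a) D a.
pose le b a := (b == a) || r b a.
have -> : \sum_a D a * Num.max 0 (w - mass_ge r D a) =
    \sum_(a | P a) D a * (w - mass_ge r D a).
  rewrite [LHS](bigID P) /= [X in _ + X]big1 ?addr0.
    by apply: eq_bigr => a Pa; rewrite max_r // subr_ge0 ltW.
  by move=> a; rewrite /P -leNgt => Pa; rewrite max_l ?mulr0 // subr_le0.
have pair_sum : s ^+ 2 <= 2 * \sum_(a | P a) \sum_(b | P b) D a * D b * (le b a)%:R.
  rewrite expr2 mulr_suml mulrDl mul1r {2}exchange_big /= -big_split /=.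
  apply: ler_sum => a Pa; rewrite mulr_sumr -big_split /=.
  apply: ler_sum => b Pb; rewrite (mulrC (D b)) -mulrDr.
  rewrite ler_peMr ?mulr_ge0 // -natrD ler1n /le.
  by case: (eqVneq b a) => [//|/tot] /=; case: (r b a) => //= ->.
have ge_pairs : \sum_(a | P a) \sum_(b | P b) D a * D b * (le b a)%:R <=
    \sum_(a | P a) D a * mass_ge r D a.
  apply: ler_sum => a Pa; rewrite /mass_ge mulr_sumr.
  rewrite [leRHS]big_mkcond [leLHS]big_mkcond /=.
  apply: ler_sum => b _; rewrite /le.
  by case: (P b); case: (_ || _); rewrite ?mulr1 ?mulr0 ?mulr_ge0.
under eq_bigr do rewrite mulrBr.
rewrite sumrB -mulr_suml -/s.
have := sqr_ge0 (w - s); move: pair_sum ge_pairs; nra.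
Qed.

(* Regret matching: play each candidate with probability proportional to the positive
   part of its cumulative regret. That vector is orthogonal to the instantaneous
   regrets, so its squared norm grows only linearly with time. *)
Section RegretMatching.
Variables (R : realType) (C : finType) (c0 : C) (U : (C -> R) -> C -> R).

(** When no entry is positive there is nothing to normalize, and the play defaults to the point mass
    at [c0]. *)
Definition matching_play (x : C -> R) (a : C) : R :=
  let s := \sum_b Num.max 0 (x b) in
  if s == 0 then (a == c0)%:R else Num.max 0 (x a) / s.

Definition regret (D : C -> R) (a : C) : R := U D a - \sum_b D b * U D b.

Definition cumulative_regret (n : nat) : C -> R :=
  iter n (fun x a => x a + regret (matching_play x) a) (fun=> 0).

Lemma matching_play_lottery (x : C -> R) : lottery (matching_play x).
Proof.
rewrite /lottery /matching_play; case: eqP => [_|/eqP s0].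
  split=> [a|]; first by rewrite ler0n.
  by rewrite (bigD1 c0) //= eqxx big1 ?addr0 // => a /negbTE ->.
have pos a : 0 <= Num.max 0 (x a) by rewrite le_max lexx.
split=> [a|]; first by rewrite divr_ge0 // sumr_ge0.
by rewrite -mulr_suml mulfV.
Qed.

(** The positive part is a multiple of the play itself, and the mean regret under the play is
    zero. *)
Lemma matching_play_orthogonal (x : C -> R) :
  \sum_a Num.max 0 (x a) * regret (matching_play x) a = 0.
Proof.
have pos a : 0 <= Num.max 0 (x a) by rewrite le_max lexx.
have [_ D1] := matching_play_lottery x.
set D := matching_play x.
have -> : \sum_a Num.max 0 (x a) * regret D a =
   (\sum_b Num.max 0 (x b)) * \sum_a D a * regret D a.
  rewrite mulr_sumr; apply: eq_bigr => a _; rewrite mulrA; congr (_ * _).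
  rewrite /D /matching_play; case: eqP => [s0|/eqP s0].
    by rewrite s0 mul0r (psumr_eq0P _ s0).
  by rewrite mulrCA mulfV ?mulr1.
suff -> : \sum_a D a * regret D a = 0 by rewrite mulr0.
under eq_bigr do rewrite /regret mulrBr.
by rewrite sumrB -mulr_suml D1 mul1r subrr.
Qed.

(** The squared positive part of [y + d] is at most that of [y], plus [d ^+ 2], plus twice [d] times
    the positive part of [y]. Summed over candidates, the cross terms cancel by orthogonality. *)
Lemma sqr_cumulative_regret (M : R) (n : nat) :
  (forall D a, lottery D -> 0 <= U D a <= M) ->
  \sum_a Num.max 0 (cumulative_regret n a) ^+ 2 <= n%:R * (#|C|%:R * M ^+ 2).
Proof.
move=> UM; elim: n => [|n IHn].
  by rewrite mul0r big1 // => a _; rewrite max_l // expr0n.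
set x := cumulative_regret n in IHn.
have [D0 D1] := matching_play_lottery x.
set D := matching_play x in D0 D1.
have step a : Num.max 0 (cumulative_regret n.+1 a) ^+ 2 <=
    Num.max 0 (x a) ^+ 2 + 2 * (Num.max 0 (x a) * regret D a) + M ^+ 2.
  rewrite /= -/x -/D.
  have reg : - M <= regret D a <= M.
    have Dl : lottery D by split.
    have /andP[u0 uM] := UM D a Dl.
    have : 0 <= \sum_b D b * U D b.
      by apply: sumr_ge0 => b _; rewrite mulr_ge0 //; have /andP[] := UM D b Dl.
    have : \sum_b D b * U D b <= M.
      rewrite -[leRHS]mul1r -D1 mulr_suml; apply: ler_sum => b _.
      by rewrite ler_wpM2l //; have /andP[] := UM D b Dl.
    rewrite /regret; lra.
  have sqr : regret D a ^+ 2 <= M ^+ 2 by move/andP: reg => [? ?]; nra.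
  move: (regret D a) sqr (x a) => d sqr y.
  case: (leP 0 (y + d)) => h1; case: (leP 0 y) => h2; nra.
apply: le_trans (_ : _ <= \sum_a (Num.max 0 (x a) ^+ 2
   + 2 * (Num.max 0 (x a) * regret D a) + M ^+ 2)) _; first exact: ler_sum.
rewrite !big_split /= -mulr_sumr matching_play_orthogonal sum_const_card.
rewrite -[n.+1]addn1 natrD; lra.
Qed.

Lemma cumulative_regretE (n : nat) (a : C) :
  cumulative_regret n a =
  \sum_(t < n) regret (matching_play (cumulative_regret t)) a.
Proof. by elim: n => [|n IHn]; rewrite ?big_ord0 // big_ord_recr /= -IHn. Qed.

Lemma no_regret (M e : R) :
  (forall D a, lottery D -> 0 <= U D a <= M) -> 0 < e ->
  exists (n : nat) (A : nat -> C -> R), (0 < n)%N /\ (forall t, lottery (A t)) /\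
    forall a, \sum_(t < n) regret (A t) a <= n%:R * e.
Proof.
move=> UM e0; pose K := #|C|%:R * M ^+ 2.
have K0 : 0 <= K by rewrite mulr_ge0 ?ler0n ?sqr_ge0.
(* The squared regret is at most [n%:R * K], which this [n] makes smaller than [(n%:R * e) ^+ 2]. *)
have [n n_gt0 nK] : exists2 n, (0 < n)%N & K < n%:R * e ^+ 2.
  exists (Num.truncn (K / e ^+ 2)).+1 => //.
  by rewrite -ltr_pdivrMr ?exprn_gt0 // truncnS_gt.
exists n, (fun t => matching_play (cumulative_regret t)).
split=> //; split=> [t|a]; first exact: matching_play_lottery.
rewrite -cumulative_regretE.
have := sqr_cumulative_regret n UM; rewrite (bigD1 a) //= => sq.
have {}sq : Num.max 0 (cumulative_regret n a) ^+ 2 <= n%:R * K.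
  by apply: le_trans sq; rewrite lerDl sumr_ge0 // => b _; rewrite sqr_ge0.
have n0 : 0 < n%:R :> R by rewrite ltr0n.
rewrite leNgt; apply/negP => lt; move: sq.
have ne : 0 < n%:R * e by rewrite mulr_gt0.
rewrite max_r; last by rewrite ltW // (lt_trans ne).
move: (cumulative_regret n a) lt => x lt.
have : (n%:R * e) ^+ 2 < x ^+ 2 by rewrite !expr2 ltr_pM // ltW.
have : n%:R * K < n%:R * (n%:R * e ^+ 2) by rewrite ltr_pM2l.
nra.
Qed.

End RegretMatching.

(** * A lottery balanced against every candidate *)

Lemma exists_balanced_lottery (R : realType) (V C : finType) (c0 : C)
    (pref : V -> rel C) (w e : R) :
  (0 < #|V|)%N -> (forall v, strict_linear_order (pref v)) -> 0 <= w -> 0 < e ->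
  exists D : C -> R, lottery D /\
    forall a, \sum_v Num.max 0 (w - mass_ge (pref v) D a) <= #|V|%:R * (w ^+ 2 / 2 + e).
Proof.
move=> V0 lin w0 e0.
have V0R : 0 < #|V|%:R :> R by rewrite ltr0n.
pose U (D : C -> R) a := (\sum_v Num.max 0 (w - mass_ge (pref v) D a)) / #|V|%:R.
have UM D a : lottery D -> 0 <= U D a <= w.
  move=> [D0 _]; apply/andP; split.
    by rewrite divr_ge0 ?ler0n // sumr_ge0 // => v _; rewrite le_max lexx.
  rewrite ler_pdivrMr // mulrC -sum_const_card.
  apply: ler_sum => v _; rewrite ge_max w0 gerBl; exact: sumr_ge0.
have [n [A [n0 [Alot reg]]]] := no_regret c0 UM e0.
have n0R : 0 < n%:R :> R by rewrite ltr0n.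
pose D a := (\sum_(t < n) A t a) / n%:R.
have Dlot : lottery D.
  split=> [a|].
    by rewrite divr_ge0 ?ler0n // sumr_ge0 // => t _; have [] := Alot t.
  rewrite -mulr_suml exchange_big /= (eq_bigr (fun=> 1)) => [|t _]; last first.
    by have [] := Alot t.
  by rewrite sumr_const card_ord mulfV // gt_eqF.
exists D; split=> // a.
(* [mass_ge] is linear in the lottery, so the clipped payoff is convex and Jensen's inequality
   applies to the average of the plays. *)
have jensen v : Num.max 0 (w - mass_ge (pref v) D a) <=
    (\sum_(t < n) Num.max 0 (w - mass_ge (pref v) (A t) a)) / n%:R.
  have pos t : 0 <= Num.max 0 (w - mass_ge (pref v) (A t) a).
    by rewrite le_max lexx.
  rewrite ge_max divr_ge0 ?sumr_ge0 ?ler0n //=.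
  rewrite ler_pdivlMr // mulrBl /mass_ge mulr_suml.
  under [X in _ - X]eq_bigr do rewrite /D divfK ?gt_eqF //.
  rewrite exchange_big /= mulr_natr -[n in w *+ n]card_ord -sumr_const -sumrB.
  by apply: ler_sum => t _; rewrite le_max lexx orbT.
apply: le_trans (ler_sum _ (fun v _ => jensen v)) _.
rewrite -mulr_suml exchange_big /= ler_pdivrMr //.
have -> : \sum_(t < n) \sum_v Num.max 0 (w - mass_ge (pref v) (A t) a) =
    #|V|%:R * \sum_(t < n) U (A t) a.
  rewrite mulr_sumr; apply: eq_bigr => t _.
  by rewrite /U mulrC divfK ?gt_eqF.
rewrite -mulrA ler_pM2l //.
(* Each play earns at most [w ^+ 2 / 2] against itself, voter by voter; the regret bound transfers
   this to every fixed [a]. *)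
have self (t : 'I_n) : \sum_b A t b * U (A t) b <= w ^+ 2 / 2.
  rewrite /U; under eq_bigr do rewrite mulrA mulr_sumr.
  rewrite -mulr_suml exchange_big /= ler_pdivrMr // mulrC -sum_const_card.
  by apply: ler_sum => v _; apply: lottery_self_payoff => //; have [] := Alot t.
have {}self : \sum_(t < n) \sum_b A t b * U (A t) b <= n%:R * (w ^+ 2 / 2).
  rewrite mulr_natl -[n in leRHS]card_ord -sumr_const; exact: ler_sum.
have := reg a; rewrite sumrB; lra.
Qed.

(** * Sampling candidates from a lottery *)

Lemma mass_above_cons_le (R : realType) (C : finType) (r : rel C) (D : C -> R) b s :
  (forall a, 0 <= D a) -> mass_above r D (b :: s) <= mass_above r D s.
Proof. by move=> D0; apply: ler_sum_subpred => // a /= /andP[]. Qed.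

Lemma mass_low_rank (R : realType) (C : finType) (r : rel C) (D : C -> R) (t : R) :
  strict_linear_order r -> lottery D -> t <= 1 ->
  \sum_(b | t < mass_above r D [:: b]) D b <= 1 - t.
Proof.
move=> [irr [tr tot]] [D0 D1] t1; pose Q b := t < mass_above r D [:: b].
case: (pickP Q) => [b0 Qb0|Q0]; last by rewrite big_pred0 // subr_ge0.
(* Having the fewest candidates above it makes [b] the top of [Q]. So [Q] avoids the candidates
   above [b], whose mass exceeds [t]. *)
case: (@arg_minnP _ b0 Q (fun b => #|[pred x | r x b]|) Qb0) => b Qb bmin.
suff : \sum_(x | Q x) D x <= \sum_(x | ~~ all (r x) [:: b]) D x.
  move=> h; apply: le_trans h _; rewrite -D1 [X in X - t](bigID (fun x => all (r x) [:: b])) /=.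
  by move: Qb; rewrite /Q /mass_above /=; set y := \sum_(_ | _) _; lra.
apply: ler_sum_subpred => // x Qx; rewrite /= andbT; apply/negP => rxb.
have := bmin x Qx; rewrite leqNgt => /negP; apply.
apply: proper_card; apply/properP; split.
  by apply/fintype.subsetP => y; rewrite !inE => /tr; apply.
by exists x; rewrite !inE ?irr.
Qed.

Lemma mass_above_step (R : realType) (C : finType) (r : rel C) (D : C -> R) (t : R) s :
  strict_linear_order r -> lottery D -> t <= 1 ->
  \sum_b D b * (t < mass_above r D (b :: s))%R%:R <= (1 - t) * (t < mass_above r D s)%R%:R.
Proof.
move=> lin Dlot t1; have [D0 D1] := Dlot.
case: (ltP t (mass_above r D s)) => h; rewrite ?mulr1 ?mulr0; last first.
  rewrite big1 // => b _; rewrite ltNge (le_trans _ h) ?mulr0 //.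
  exact: mass_above_cons_le.
apply: le_trans (mass_low_rank lin Dlot t1).
rewrite [leRHS]big_mkcond; apply: ler_sum => b _.
have le : mass_above r D (b :: s) <= mass_above r D [:: b].
  by apply: ler_sum_subpred => // a /= /andP[->].
case: (ltP t _) => [lt|_]; first by rewrite mulr1 (lt_le_trans lt le).
by rewrite mulr0; case: ifP.
Qed.

Lemma lottery_ex_le (R : realType) (C : finType) (D f : C -> R) (x : R) :
  lottery D -> \sum_b D b * f b <= x -> exists b, f b <= x.
Proof.
move=> [D0 D1] le; apply: contrapT => /forallNP no.
have gt b : x < f b by rewrite ltNge; apply/negP/no.
have [b Db] : exists b, 0 < D b.
  apply: contrapT => /forallNP D_le0.
  have : \sum_a D a <= 0 by apply: sumr_le0 => a _; rewrite leNgt; apply/negP/D_le0.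
  by rewrite D1 ler10.
move: le; rewrite leNgt => /negP; apply.
rewrite -[ltLHS]mul1r -D1 mulr_suml (bigD1 b) //= [ltRHS](bigD1 b) //=.
by rewrite ltr_leD ?ltr_pM2l // ler_sum // => a _; rewrite ler_wpM2l // ltW.
Qed.

(* Derandomizes m independent draws from D by conditional expectations: a single
   draw multiplies the probability that mass_above exceeds t by at most 1 - t. *)
Lemma exists_sample (R : realType) (V C I : finType) (pref : V -> rel C) (D : C -> R)
    (t c : I -> R) (m : nat) :
  (forall v, strict_linear_order (pref v)) -> lottery D ->
  (forall i, t i < 1) -> (forall i, 0 <= c i) ->
  exists s : seq C, size s = m /\
    \sum_v \sum_i c i * (t i < mass_above (pref v) D s)%R%:R <=
    #|V|%:R * \sum_i c i * (1 - t i) ^+ m.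
Proof.
move=> lin Dlot t1; elim: m c => [|m IHm] c c0.
  exists [::]; split=> //; rewrite -sum_const_card.
  apply: ler_sum => v _; apply: ler_sum => i _.
  by rewrite expr0 mulr1 ler_piMr // lern1 leq_b1.
have [i|s [sz le]] := IHm (fun i => c i * (1 - t i)).
  by rewrite mulr_ge0 // subr_ge0 ltW.
have [|b bP] := @lottery_ex_le _ _ D
  (fun b => \sum_v \sum_i c i * (t i < mass_above (pref v) D (b :: s))%R%:R)
  (#|V|%:R * \sum_i c i * (1 - t i) ^+ m.+1) Dlot; last first.
  by exists (b :: s); rewrite /= sz.
under [X in _ * X]eq_bigr do rewrite exprS mulrA.
apply: le_trans le.
under eq_bigr do rewrite mulr_sumr.
rewrite exchange_big /=; apply: ler_sum => v _.
under eq_bigr do rewrite mulr_sumr.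
rewrite exchange_big /=; apply: ler_sum => i _.
under eq_bigr do rewrite mulrCA.
by rewrite -mulr_sumr -mulrA ler_wpM2l // mass_above_step // ltW.
Qed.

(** * Completing samples to committees *)

Lemma exists_superset_card (C : finType) (A : {set C}) (k : nat) :
  (#|A| <= k <= #|C|)%N -> exists S : {set C}, A \subset S /\ #|S| = k.
Proof.
move=> /andP[Ak kC]; elim: k Ak kC => [|k IHk] Ak kC.
  by exists A; split=> //; apply/eqP; rewrite -leqn0.
move: Ak; rewrite leq_eqVlt => /orP[/eqP <-|Ak]; first by exists A.
have [S [AS Sk]] := IHk Ak (ltnW kC).
have [x xS] : exists x, x \notin S.
  apply/existsP; rewrite -negb_forall; apply/negP => /forallP all_S.
  by move: kC; rewrite -Sk ltnNge => /negP; apply; apply/subset_leq_card/fintype.subsetP.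
by exists (x |: S); rewrite cardsU1 xS Sk (fintype.subset_trans AS) ?finset.subsetU1.
Qed.

Lemma exists_committee (C : finType) (s : seq C) (k : nat) :
  (size s <= k <= #|C|)%N -> exists S : {set C}, #|S| = k /\ {subset s <= S}.
Proof.
move=> /andP[sk kC].
have [|S [sS Sk]] := @exists_superset_card _ [set x in s]%SET k.
  by rewrite kC cardsE (leq_trans (card_size s)).
by exists S; split=> // x xs; apply: (fintype.subsetP sS); rewrite inE.
Qed.

Lemma mass_ge_le_above (R : realType) (C : finType) (r : rel C) (D : C -> R) a s
    (S : {set C}) :
  strict_linear_order r -> (forall b, 0 <= D b) -> {subset s <= S} ->
  prefers_to_all r a S -> mass_ge r D a <= mass_above r D s.
Proof.
move=> [_ [tr _]] D0 sS /forallP aS; apply: ler_sum_subpred => // b ba.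
apply/allP => x /sS xS; have /implyP/(_ xS) rax := aS x.
by case/orP: ba => [/eqP -> //|/tr]; apply.
Qed.

Lemma card_prefers_sum (R : realType) (V C : finType) (pref : V -> rel C) a S :
  #|[set v | prefers_to_all (pref v) a S]%SET|%:R =
  \sum_v (prefers_to_all (pref v) a S)%:R :> R.
Proof.
rewrite -sum1_card natr_sum big_mkcond /=; apply: eq_bigr => v _.
by rewrite inE; case: ifP.
Qed.

(** * Expected excess through Riemann sums *)

Lemma min_le_threshold_sum (R : realType) (e d y : R) (n : nat) : 0 <= d ->
  Num.min (y - e) (n%:R * d) <= \sum_(i < n) d * (e + i%:R * d < y)%R%:R.
Proof.
move=> d0; elim: n => [|n IHn]; first by rewrite big_ord0 mul0r ge_min lexx orbT.
have nS : n.+1%:R * d = n%:R * d + d by rewrite -[n.+1]addn1 natrD mulrDl mul1r.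
rewrite big_ord_recr /= nS; move: IHn; set s := \sum_(_ < _) _.
case: (ltP (e + n%:R * d)) => h /=; rewrite ?mulr1 ?mulr0;
  case: (leP (y - e) (n%:R * d)); case: (leP (y - e) (n%:R * d + d)); lra.
Qed.

Lemma ler_exp_tangent (R : realType) (y d : R) (k : nat) : 0 <= y -> 0 <= d ->
  k.+1%:R * (d * y ^+ k) <= (y + d) ^+ k.+1 - y ^+ k.+1.
Proof.
move=> y0 d0; elim: k => [|k IHk]; first by rewrite !expr1 expr0; lra.
have yk : 0 <= y ^+ k by rewrite exprn_ge0.
have : (y + d) * (y ^+ k.+1 + k.+1%:R * (d * y ^+ k)) <= (y + d) * (y + d) ^+ k.+1.
  by rewrite ler_wpM2l ?addr_ge0 //; lra.
have : 0 <= k.+1%:R * (d ^+ 2 * y ^+ k) by rewrite !mulr_ge0 ?ler0n ?sqr_ge0.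
rewrite -[k.+2]addn1 natrD [(y + d) ^+ (_ + 1)]exprD addn1 expr1.
rewrite [y ^+ k.+2]exprS [y ^+ k.+1]exprS; nra.
Qed.

(** Since [(x - u) ^+ k] decreases in [u], each term but the first is at most the integral over the
    preceding cell, by the tangent inequality; the first term is kept as the error. *)
Lemma left_riemann_sum_exp (R : realType) (x d : R) (n k : nat) :
  0 <= d -> n%:R * d <= x ->
  k.+1%:R * \sum_(i < n.+1) d * (x - i%:R * d) ^+ k <=
  k.+1%:R * (d * x ^+ k) + x ^+ k.+1 - (x - n%:R * d) ^+ k.+1.
Proof.
move=> d0; elim: n => [_|n IHn nx].
  by rewrite big_ord_recl big_ord0 /= mul0r subr0 addr0 addrK.
rewrite big_ord_recr /= mulrDr.
have nS : n.+1%:R * d = n%:R * d + d by rewrite -[n.+1]addn1 natrD mulrDl mul1r.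
rewrite nS in nx *; have {}IHn := IHn ltac:(lra).
have := @ler_exp_tangent _ (x - (n%:R * d + d)) d k.
rewrite [_ - _ + d](_ : _ = x - n%:R * d); last by ring.
have := IHn; lra.
Qed.

(** The excess over [e] is the integral over [t >= e] of the indicator that [mass_above] exceeds
    [t]. A grid of mesh [d] replaces this integral, and one sample serves the weighted sum of all
    its thresholds. *)
Lemma exists_sample_excess (R : realType) (V C : finType) (pref : V -> rel C) (D : C -> R)
    (e h : R) (k : nat) :
  (forall v, strict_linear_order (pref v)) -> lottery D -> 0 <= e < 1 -> 0 < h ->
  exists s : seq C, size s = k /\
    \sum_v Num.max 0 (mass_above (pref v) D s - e) <=
    #|V|%:R * ((1 - e) ^+ k.+1 / k.+1%:R + h).
Proof.
move=> lin Dlot /andP[e0 e1] h0; have [D0 D1] := Dlot.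
have [n nh] : exists n, h^-1 < n.+1%:R by exists (Num.truncn h^-1); exact: truncnS_gt.
pose d := (1 - e) / n.+1%:R.
have n0 : 0 < n.+1%:R :> R by rewrite ltr0n.
have d0 : 0 < d by rewrite divr_gt0 // subr_gt0.
have nd : n.+1%:R * d = 1 - e by rewrite mulrC divfK // gt_eqF.
have dh : d <= h.
  have : 1 <= n.+1%:R * h.
    by rewrite -ler_pdivrMr // div1r ltW.
  move=> nh1; have : n.+1%:R * d <= n.+1%:R * h by rewrite nd; lra.
  by rewrite ler_pM2l.
have t1 (i : 'I_n.+1) : e + i%:R * d < 1.
  have : i%:R * d < n.+1%:R * d by rewrite ltr_pM2r // ltr_nat.
  by rewrite nd; lra.
have [s [sz le]] := @exists_sample R V C _ pref D (fun i : 'I_n.+1 => e + i%:R * d)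
  (fun=> d) k lin Dlot t1 (fun=> ltW d0).
exists s; split=> //.
apply: le_trans (_ : _ <= \sum_v \sum_(i < n.+1) d *
   (e + i%:R * d < mass_above (pref v) D s)%R%:R) _.
  apply: ler_sum => v _; rewrite ge_max sumr_ge0 /= => [|i _]; last first.
    by rewrite mulr_ge0 // ltW.
  (* The cap [n.+1%:R * d = 1 - e] does not bind, because a mass is at most 1. *)
  apply: le_trans (min_le_threshold_sum _ _ _ (ltW d0)).
  rewrite le_min lexx nd lerD2r -D1 [leRHS](bigID (fun b => all (pref v b) s)) /=.
  by rewrite lerDl sumr_ge0.
apply: le_trans le _; rewrite ler_wpM2l ?ler0n //.
have k0 : 0 < k.+1%:R :> R by rewrite ltr0n.
have nx : n%:R * d <= 1 - e by rewrite -nd ler_pM2r // ler_nat.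
have := left_riemann_sum_exp k (ltW d0) nx.
under [X in _ -> X <= _]eq_bigr do rewrite opprD addrA.
have xn : 0 <= (1 - e - n%:R * d) ^+ k.+1 by rewrite exprn_ge0 // subr_ge0.
have xk : d * (1 - e) ^+ k <= h.
  by apply: le_trans dh; rewrite ler_piMr ?(ltW d0) // exprn_ile1; lra.
rewrite -(ler_pM2l k0) [k.+1%:R * (_ + h)]mulrDr [k.+1%:R * (_ / _)]mulrC divfK ?gt_eqF //.
move=> sum; apply: le_trans sum _.
have : k.+1%:R * (d * (1 - e) ^+ k) <= k.+1%:R * h by rewrite ler_pM2l.
lra.
Qed.

(** * Achievable thresholds and their infimum *)

Definition achievable (R : realType) (k : nat) (x : R) : Prop :=
  forall (V C : finType) (pref : V -> rel C), (0 < #|V|)%N -> (k <= #|C|)%N ->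
  (forall v, strict_linear_order (pref v)) ->
  exists S : {set C}, #|S| = k /\ undominated pref x S.

Lemma dom_shareE (R : realType) (V C : finType) (pref : V -> rel C) a S :
  dom_share R pref a S = (\sum_v (prefers_to_all (pref v) a S)%:R) / #|V|%:R.
Proof. by rewrite /dom_share card_prefers_sum. Qed.

(** Any election with a candidate shows this, shares being nonnegative; one voter and [k] candidates
    suffice. It bounds below the set whose infimum is [alpha_k]. *)
Lemma achievable_gt0 (R : realType) (k : nat) (x : R) :
  (0 < k)%N -> achievable k x -> 0 < x.
Proof.
move=> k0 xk; have [|||S [_ /(_ (Ordinal k0))]] :=
    xk unit 'I_k (fun _ a b => (a < b)%N).
- by rewrite card_unit.
- by rewrite card_ord.
- move=> _; split=> [a|]; first exact: ltnn.
  split=> [b a c|a b]; first exact: ltn_trans.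
  by rewrite -neq_ltn.
by apply: le_lt_trans; rewrite dom_shareE divr_ge0 ?ler0n // sumr_ge0.
Qed.

Lemma alpha_k_le (R : realType) (k : nat) (x : R) :
  (0 < k)%N -> achievable k x -> alpha_k R k <= x.
Proof.
move=> k0 xk; apply: ge_inf => //.
by exists 0 => y /(achievable_gt0 k0)/ltW.
Qed.

Lemma achievable_gt1 (R : realType) (k : nat) (x : R) : 1 < x -> achievable k x.
Proof.
move=> x1 V C pref V0 kC lin.
have [//|S [Sk _]] := @exists_committee C [::] k.
exists S; split=> // a; apply: le_lt_trans x1.
rewrite dom_shareE ler_pdivrMr ?ltr0n // mulrC -sum_const_card.
by apply: ler_sum => v _; rewrite lern1 leq_b1.
Qed.

Lemma alpha_k_le1 (R : realType) (k : nat) : (0 < k)%N -> alpha_k R k <= 1.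
Proof.
move=> k0; apply/ler_addgt0Pr => e e0; apply: alpha_k_le => //.
by apply: achievable_gt1; rewrite ltrDl.
Qed.

Lemma alpha_k_adherent (R : realType) (k : nat) (e : R) : (0 < k)%N -> 0 < e ->
  exists2 y, achievable k y & y < alpha_k R k + e.
Proof.
move=> k0 e0; apply: inf_adherent => //; split.
  by exists 2; apply: achievable_gt1; rewrite ltr1n.
by exists 0 => y /(achievable_gt0 k0)/ltW.
Qed.

(** * Thresholds obtained by sampling *)

Lemma achievable_clip (R : realType) (k : nat) (w e h : R) :
  (0 < k)%N -> 0 <= e < 1 -> e < w -> 0 < h ->
  achievable k ((w ^+ 2 / 2 + (1 - e) ^+ k.+1 / k.+1%:R + h) / (w - e)).
Proof.
move=> k0 e01 ew h0 V C pref V0 kC lin.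
have V0R : 0 < #|V|%:R :> R by rewrite ltr0n.
have /card_gt0P[c0 _] : (0 < #|C|)%N by apply: leq_trans kC.
(* The lottery and the sample each cost [h / 3]; the last third makes the inequality strict. *)
have h3 : 0 < h / 3 by rewrite divr_gt0.
have w0 : 0 <= w by case/andP: e01; lra.
have [D [Dlot bal]] := exists_balanced_lottery c0 V0 lin w0 h3.
have [s [sz exc]] := exists_sample_excess k lin Dlot e01 h3.
have [|S [Sk sS]] := @exists_committee _ s k; first by rewrite sz leqnn.
exists S; split=> // a.
have we : 0 < w - e by rewrite subr_gt0.
have pt v : (prefers_to_all (pref v) a S)%:R * (w - e) <=
    Num.max 0 (w - mass_ge (pref v) D a) + Num.max 0 (mass_above (pref v) D s - e).
  have pos x : 0 <= Num.max 0 x :> R by rewrite le_max lexx.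
  have ge x : x <= Num.max 0 x :> R by rewrite le_max lexx orbT.
  case: (boolP (prefers_to_all _ _ _)) => [aS|_]; last first.
    by rewrite mul0r addr_ge0.
  have := mass_ge_le_above (lin v) (proj1 Dlot) sS aS.
  have := ge (w - mass_ge (pref v) D a); have := ge (mass_above (pref v) D s - e).
  by rewrite mul1r; lra.
rewrite dom_shareE ltr_pdivrMr // mulrAC ltr_pdivlMr // mulr_suml.
apply: le_lt_trans (ler_sum _ (fun v _ => pt v)) _.
rewrite big_split /= mulrC.
have := bal a; have : 0 < #|V|%:R * h by rewrite mulr_gt0.
by move: exc; move: ((1 - e) ^+ k.+1 / k.+1%:R) => x; rewrite !mulrDr; lra.
Qed.

Lemma achievable_combine (R : realType) (k' m : nat) (t y h : R) :
  (0 < k')%N -> 0 < t < 1 -> 0 < h -> achievable k' y ->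
  achievable (k' + m) ((1 - t) ^+ m * y + 2 * t + h).
Proof.
move=> k'0 /andP[t0 t1] h0 yk V C pref V0 kC lin.
have y0 := achievable_gt0 k'0 yk.
have V0R : 0 < #|V|%:R :> R by rewrite ltr0n.
have k'C : (k' <= #|C|)%N by apply: leq_trans kC; rewrite leq_addr.
have /card_gt0P[c0 _] : (0 < #|C|)%N by apply: leq_trans k'C.
have w0 : 0 <= 2 * t by lra.
(* The error is later divided by [t], leaving [h / 2]. *)
have th : 0 < t * h / 2 by rewrite divr_gt0 // mulr_gt0.
have [D [Dlot bal]] := exists_balanced_lottery c0 V0 lin w0 th.
have [s [sz miss]] := @exists_sample R V C unit pref D (fun=> t) (fun=> 1) m
  lin Dlot (fun=> t1) (fun=> ler01).
pose U := [set v | t < mass_above (pref v) D s]%SET.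
have cardU : #|U|%:R <= #|V|%:R * (1 - t) ^+ m.
  have : \sum_v \sum_(i : unit) 1 * (t < mass_above (pref v) D s)%R%:R = #|U|%:R :> R.
    rewrite -sum1_card natr_sum [RHS]big_mkcond /=; apply: eq_bigr => v _.
    by rewrite sum_const_card card_unit !mul1r inE; case: ifP.
  by move: miss; rewrite sum_const_card card_unit !mul1r => /[swap] ->.
have [T [Tk Tdom]] : exists T : {set C}, #|T| = k' /\ forall a,
    \sum_(v in U) (prefers_to_all (pref v) a T)%:R <= #|V|%:R * (1 - t) ^+ m * y.
  (* An election needs a voter, so the case of empty [U] is separate; there any committee of size
     [k'] works. *)
  have [/eqP U0|/set0Pn[u uU]] := boolP (U == finset.set0).
    have [//|T [Tk _]] := @exists_committee C [::] k'.
    exists T; split=> // a; rewrite U0 big_set0.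
    by rewrite !mulr_ge0 ?ler0n ?exprn_ge0 //; lra.
  have U_gt0 : (0 < #|{: {v in U}}|)%N by apply/card_gt0P; exists (exist _ u uU).
  have [|T [Tk Tdom]] := yk _ C (fun v : {v in U} => pref (val v)) U_gt0 k'C.
    by move=> v; apply: lin.
  exists T; split=> // a; rewrite big_sub.
  have := Tdom a; rewrite dom_shareE ltr_pdivrMr ?ltr0n // => /ltW le.
  apply: le_trans le _; rewrite mulrC ler_wpM2r ?(ltW y0) //.
  by rewrite card_sig; apply: le_trans cardU.
(* The sample may repeat candidates or meet [T]; padding restores the exact size. *)
have [|S [Sk sS]] := @exists_committee C (s ++ enum T) (k' + m).
  by rewrite size_cat sz -cardE Tk addnC leqnn.
exists S; split=> // a.
have pt v : (prefers_to_all (pref v) a S)%:R <=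
    (if v \in U then (prefers_to_all (pref v) a T)%:R else 0) +
    Num.max 0 (2 * t - mass_ge (pref v) D a) / t.
  have pos : 0 <= Num.max 0 (2 * t - mass_ge (pref v) D a) / t.
    by rewrite divr_ge0 ?(ltW t0) // le_max lexx.
  case: (boolP (prefers_to_all _ _ S)) => [aS|_]; last first.
    by case: ifP => _; rewrite addr_ge0 ?ler0n.
  rewrite inE; case: ltP => [_|le].
    suff -> : prefers_to_all (pref v) a T by rewrite lerDl.
    apply/forallP => b; apply/implyP => bT.
    by have /implyP := forallP aS b; apply; apply: sS; rewrite mem_cat mem_enum bT orbT.
  have sS' : {subset s <= S} by move=> x xs; apply: sS; rewrite mem_cat xs.
  have := mass_ge_le_above (lin v) (proj1 Dlot) sS' aS.
  rewrite add0r ler_pdivlMr // mul1r => ab.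
  by apply: le_trans (_ : t <= 2 * t - mass_ge (pref v) D a) _; [lra|rewrite le_max lexx orbT].
rewrite dom_shareE ltr_pdivrMr //.
apply: le_lt_trans (ler_sum _ (fun v _ => pt v)) _.
rewrite big_split /= -big_mkcond /= -mulr_suml.
have : (\sum_v Num.max 0 (2 * t - mass_ge (pref v) D a)) / t <= #|V|%:R * (2 * t + h / 2).
  rewrite ler_pdivrMr //; apply: le_trans (bal a) _; rewrite -(mulrA #|V|%:R) ler_pM2l //; lra.
have := Tdom a; have : 0 < #|V|%:R * h by rewrite mulr_gt0.
by rewrite [X in _ < X]mulrC !mulrDr; lra.
Qed.

(** * The two bounds on [alpha_k] *)

Lemma alpha_k_log_bound (R : realType) (k : nat) : (0 < k)%N ->
  alpha_k R k / (1 - ln (alpha_k R k)) <= 2 / (k%:R + 1).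
Proof.
move=> k0; set A := alpha_k R k.
have A1 : A <= 1 by exact: alpha_k_le1.
have lnA : ln A <= 0 by apply: ln_le0.
have kR : 0 < k%:R + 1 :> R by rewrite ltr_wpDl ?ler0n.
have l0 : 0 < 1 - ln A by lra.
rewrite leNgt; apply/negP => gt.
have A0 : 0 < A.
  have : 0 < A / (1 - ln A) by apply: lt_trans gt; rewrite divr_gt0.
  by rewrite pmulr_lgt0 // invr_gt0.
(* The cutoff is [e = 1 - q] with [q ^+ k = A]; [expR x >= 1 + x] bounds [k%:R * (1 - q)] by
   [- ln A]. *)
pose q := expR (ln A / k%:R).
have kR0 : 0 < k%:R :> R by rewrite ltr0n.
have qk : q ^+ k = A.
  by rewrite /q -expRM_natl mulrC divfK ?gt_eqF // lnK // posrE.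
have q0 : 0 < q by rewrite expR_gt0.
have q1 : q <= 1 by rewrite expR_le1 pmulr_lle0 ?invr_gt0.
have kq : k%:R * (1 - q) <= - ln A.
  have := expR_ge1Dx (ln A / k%:R); rewrite -/q -(ler_pM2l kR0) => hq.
  by move: hq; rewrite mulrDr mulrCA mulfV ?gt_eqF //; lra.
have A_gt : 2 * (1 + k%:R * (1 - q)) < A * (k%:R + 1).
  move: gt; rewrite ltr_pdivlMr // mulrAC ltr_pdivrMr // => gt; lra.
have ew : 1 - q < A.
  suff : (1 - q) * (k%:R + 1) < A * (k%:R + 1) by rewrite ltr_pM2r.
  have : 0 <= k%:R * (1 - q) by rewrite mulr_ge0 ?ler0n ?subr_ge0.
  lra.
pose N := A ^+ 2 / 2 + q ^+ k.+1 / k.+1%:R.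
have NA : N < A * (A - (1 - q)).
  rewrite /N [q ^+ _]exprSr qk -[k.+1]addn1 natrD -(ltr_pM2r kR) [ltLHS]mulrDl divfK ?gt_eqF //.
  have : A * (2 * (1 + k%:R * (1 - q))) < A * (A * (k%:R + 1)) by rewrite ltr_pM2l.
  lra.
(* Half of the gap in [NA], so that the achievable threshold stays below [A]. *)
pose h := (A * (A - (1 - q)) - N) / 2.
have h0 : 0 < h by rewrite divr_gt0 // subr_gt0.
have e01 : 0 <= 1 - q < 1 by lra.
have := alpha_k_le k0 (achievable_clip k0 e01 ew h0).
rewrite -/A subKr ler_pdivlMr ?subr_gt0 // -/N leNgt => /negP; apply.
rewrite /h; lra.
Qed.

Lemma alpha_k_recursive_bound (R : realType) (k k' : nat) : (0 < k')%N -> (k' < k)%N ->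
  alpha_k R k <= (k'%:R / k%:R) ^+ 2 * alpha_k R k'
                 + 4 * ln (k%:R / k'%:R) / (k%:R - k'%:R).
Proof.
move=> k'0 k'k; have k0 : (0 < k)%N by apply: leq_trans k'k.
have k'R : 0 < k'%:R :> R by rewrite ltr0n.
have kR : 0 < k%:R :> R by rewrite ltr0n.
pose L : R := ln (k%:R / k'%:R); pose m := (k - k')%N.
have L0 : 0 < L by rewrite ln_gt0 // ltr_pdivlMr // mul1r ltr_nat.
have mE : m%:R = k%:R - k'%:R :> R by rewrite natrB // ltnW.
have mR : 0 < m%:R :> R by rewrite ltr0n subn_gt0.
(* With [t = 1 - q], the factor [(1 - t) ^+ m] is [(k'%:R / k%:R) ^+ 2], while [2 * t] is at most
   [4 * L / m%:R]. *)
pose q := expR (- (2 * L / m%:R)).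
have qm : q ^+ m = (k'%:R / k%:R) ^+ 2.
  rewrite /q -expRM_natl mulrN mulrC divfK ?gt_eqF // -mulrN expRM_natl expRN.
  by rewrite /L lnK ?posrE ?divr_gt0 // invf_div.
have q0 : 0 < q by rewrite expR_gt0.
have q1 : q < 1 by rewrite expR_lt1 oppr_lt0 divr_gt0 // mulr_gt0.
have q_ge : 1 - 2 * L / m%:R <= q by have := expR_ge1Dx (- (2 * L / m%:R)).
rewrite -qm -mE -/L.
apply/ler_addgt0Pr => e e0.
have e2 : 0 < e / 2 by rewrite divr_gt0.
(* The infimum may not be attained: half of [e] pays for [y], the other half for the error in
   [achievable_combine]. *)
have [y yk ylt] := alpha_k_adherent k'0 e2.
have t01 : 0 < 1 - q < 1 by lra.
have := @achievable_combine R k' m _ _ _ k'0 t01 e2 yk.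
rewrite subKr addnC subnK 1?ltnW // => /(alpha_k_le k0) le.
apply: le_trans le _.
have qm0 : 0 <= q ^+ m by rewrite exprn_ge0 ?ltW.
have qm1 : q ^+ m <= 1 by rewrite exprn_ile1 ?ltW.
have : q ^+ m * y <= q ^+ m * (alpha_k R k' + e / 2) by rewrite ler_wpM2l // ltW.
have : q ^+ m * (e / 2) <= e / 2 by rewrite ler_piMl // ltW.
have -> : 4 * L / m%:R = 2 * (2 * L / m%:R) by ring.
lra.
Qed.

Theorem theorem6 (R : realType) (k : nat) : (0 < k)%N ->
  alpha_k R k / (1 - ln (alpha_k R k)) <= 2 / (k%:R + 1) /\
  (forall k' : nat, (1 <= k')%N -> (k' < k)%N ->
     alpha_k R k <= (k'%:R / k%:R) ^+ 2 * alpha_k R k'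
                    + 4 * ln (k%:R / k'%:R) / (k%:R - k'%:R)).
Proof.
move=> k0; split=> [|k' k'0 k'k]; first exact: alpha_k_log_bound.
exact: alpha_k_recursive_bound.
Qed.
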